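(* Consider the difference equation $$\Delta\left\{a_n\left[\Delta\left(b_n\left(\Delta\left(c_n(\Delta(x_n+p_nx_{n-\delta}))^{\gamma}\right)\right)^{\beta}\right)\right]^{\alpha}\right\}+d_nf(x_{n-\tau})=0,\qquad n\in\mathbb{N}_0. \quad (E)$$ Assume that $\lim_{n\to\infty}p_n=p$ with $|p|<1$; that $xf(x)>0$ for all $x\neq0$; that $$\sum_{n=n_0}^{\infty}a_n^{-1/\alpha}=\sum_{n=n_0}^{\infty}b_n^{-1/\beta}=\sum_{n=n_0}^{\infty}c_n^{-1/\gamma}=\infty;$$ that $f:\mathbb{R}\to\mathbb{R}$ is continuous; and that the series $\sum_{i=n_0}^{\infty}d_i$ is divergent. Then any bounded solution $(x_n)$ of (E) is almost oscillatory, i.e. either $(x_n)$ is oscillatory or $\lim_{n\to\infty}x_n=0$.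
   Context: Notation and standing assumptions: $\mathbb{N}=\{0,1,2,\dots\}$; $\delta,\tau$ are integers with $\tau\neq\min\{-4,\delta-4\}$; $n_0\in\mathbb{N}$ with $n_0\ge\max\{1,\delta,\tau\}$; $\mathbb{N}_0=\{n_0,n_0+1,\dots\}$. The exponents $\alpha,\beta,\gamma$ are ratios of odd positive integers (so $u\mapsto u^{\alpha}$ etc. is defined on all of $\mathbb{R}$, with $u^\alpha$ having the sign of $u$). $(p_n)$ is a real sequence, $(d_n)$ is a real sequence of one sign (all terms positive or all terms negative), and $(a_n),(b_n),(c_n)$ are positive real sequences, all defined for $n\in\mathbb{N}_0$. $f:\mathbb{R}\to\mathbb{R}$ is a function; if $\tau<\min\{-4,\delta-4\}$, $f$ is in addition assumed invertible. $\Delta$ is the forward difference operator, $\Delta y_n=y_{n+1}-y_n$. A solution of (E) is a real sequence $(x_n)$ satisfying (E) for all $n\in\mathbb{N}_0$. A nontrivial solution is nonoscillatory if it is eventually positive or eventually negative, and oscillatory otherwise. *)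

(* Defs.v *)
From HB Require Import structures.
From mathcomp Require Import all_boot all_order all_algebra.
From mathcomp Require Import all_classical all_reals all_analysis.

Set Implicit Arguments.
Unset Strict Implicit.
Unset Printing Implicit Defensive.

Import Order.TTheory GRing.Theory Num.Theory.
Import numFieldNormedType.Exports.

Local Open Scope classical_set_scope.
Local Open Scope ring_scope.

Definition odd_ratio (R : realType) (r : R) : Prop :=
  exists k l : nat, [/\ odd k, odd l & r = k%:R / l%:R].

(* For [r] a ratio of odd positive integers, [u ^ r] on the whole real line:
   the odd extension of [powR], which is the usual power only for [u >= 0]. *)
Definition oddpow (R : realType) (u r : R) : R := Num.sg u * (`|u| `^ r).

(* [x_(n - k)] for an integer [k] of either sign.  The truncation to [nat] by
   the absolute value is the identity as soon as [k <= n]; this is the only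
   case used, since the equation is imposed for [n >= n0 >= max(delta, tau)]. *)
Definition delay (R : realType) (x : nat -> R) (k : int) : nat -> R :=
  fun n => x `|n%:Z - k|%N.

(* [telescope u] is the forward difference [n |-> u n.+1 - u n]. *)
Definition solution (R : realType) (n0 : nat) (delta tau : int)
    (alpha beta gamma : R) (p d a b c : nat -> R) (f : R -> R)
    (x : nat -> R) : Prop :=
  let z := fun n => x n + p n * delay x delta n in
  let y1 := fun n => c n * oddpow (telescope z n) gamma in
  let y2 := fun n => b n * oddpow (telescope y1 n) beta in
  let y3 := fun n => a n * oddpow (telescope y2 n) alpha in
  forall n, (n0 <= n)%N -> telescope y3 n + d n * f (delay x tau n) = 0.

Definition nonoscillatory (R : realType) (x : nat -> R) : Prop :=
  (\forall n \near \oo, 0 < x n) \/ (\forall n \near \oo, x n < 0).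

(* The zero sequence is neither oscillatory nor nonoscillatory. *)
Definition oscillatory (R : realType) (x : nat -> R) : Prop :=
  (exists n, x n != 0) /\ ~ nonoscillatory x.

Definition almost_oscillatory (R : realType) (x : nat -> R) : Prop :=
  oscillatory x \/ x @ \oo --> (0 : R).

(* Main.v *)
Require Import Defs.
From HB Require Import structures.
From mathcomp Require Import all_boot all_order all_algebra.
From mathcomp Require Import all_classical all_reals all_analysis.
From mathcomp Require Import zify ring lra.

Import Order.TTheory GRing.Theory Num.Theory.
Import numFieldNormedType.Exports.

Local Open Scope classical_set_scope.
Local Open Scope ring_scope.

(** Let [x] be a bounded nonoscillatory solution, and write
    [z n = x n + p n * x (n - delta)], with [y1], [y2], [y3] the successive
    quasi-differences, so that the equation reads
    [y3 n.+1 - y3 n = - d n * f (x (n - tau))].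

    The right-hand side is eventually of one strict sign, since [d] and [x]
    are, and [f] preserves signs.  This propagates downwards: a sequence whose
    differences have one sign is eventually strictly monotone, so it has one
    sign as well ([nonoscillatory_of_telescope]), and odd powers and positive
    coefficients transport signs ([nonoscillatory_oddpow]).  Hence [y3], [y2],
    [y1] and the differences of [z] are nonoscillatory.  As [z] is bounded and
    eventually monotone, it converges; as the limit of [p] is less than 1 in
    absolute value, [x] can be recovered from [z] by a contraction, and
    converges too ([is_cvg_of_add_delay]).

    Suppose the limit of [x] were nonzero.  By continuity, [f (x (n - tau))]
    stays away from 0, so the differences of [y3], which have one sign, dominate
    a positive multiple of [`|d n|], whose sum is infinite: [`|y3|] tends to
    infinity.  Since the sums of [a `^ (- alpha^-1)], [b `^ (- beta^-1)] and
    [c `^ (- gamma^-1)] are infinite, this growth passes to [`|y2|], then to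
    [`|y1|], and at last to [`|z|] ([norm_cvgy_of_oddpow]), which contradicts
    the boundedness of [z]. *)

(** * Signs and norms of odd powers *)

Lemma odd_ratio_gt0 (R : realType) (r : R) : odd_ratio r -> 0 < r.
Proof.
by case=> k [l [ok ol ->]]; rewrite divr_gt0 // ltr0n lt0n;
  [case: k ok | case: l ol].
Qed.

Lemma oddpow_gt0 (R : realType) (u r : R) : (0 < oddpow u r) = (0 < u).
Proof.
rewrite /oddpow; case: (sgrP u) => u0; rewrite ?mul0r ?mul1r ?mulN1r //.
- by rewrite powR_gt0.
- by rewrite oppr_gt0 ltNge powR_ge0.
Qed.

Lemma oddpow_lt0 (R : realType) (u r : R) : (oddpow u r < 0) = (u < 0).
Proof.
rewrite /oddpow; case: (sgrP u) => u0; rewrite ?mul0r ?mul1r ?mulN1r //.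
- by rewrite ltNge powR_ge0.
- by rewrite oppr_lt0 powR_gt0 // oppr_gt0.
Qed.

Lemma norm_oddpow (R : realType) (u r : R) : 0 < r -> `|oddpow u r| = `|u| `^ r.
Proof.
move=> r0; rewrite normrM normr_sg ger0_norm ?powR_ge0 //.
by have [->|] := eqVneq u 0; rewrite ?mul1r //= mul0r normr0 powR0 // gt_eqF.
Qed.

(** * Sequences whose differences have one sign *)

Lemma telescopeNE (R : realType) (w : nat -> R) n :
  telescope (fun n => - w n) n = - telescope w n.
Proof. by rewrite /telescope /= opprB opprK addrC. Qed.

Lemma nonoscillatoryN (R : realType) (w : nat -> R) :
  nonoscillatory w -> nonoscillatory (fun n => - w n).
Proof.
by case=> w0; [right|left]; near do rewrite (oppr_lt0, oppr_gt0).
Unshelve. all: by end_near. Qed.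

Lemma nonoscillatoryM (R : realType) (u v : nat -> R) :
  nonoscillatory u -> nonoscillatory v ->
  nonoscillatory (fun n => u n * v n).
Proof.
case=> u0 [] v0; [left|right|right|left]; near=> n.
- by apply: mulr_gt0; near: n.
- by rewrite pmulr_rlt0; near: n.
- by rewrite nmulr_rlt0; near: n.
- by rewrite nmulr_rgt0; near: n.
Unshelve. all: by end_near. Qed.

Lemma nondecreasing_of_telescope (R : realType) (w : nat -> R) (N : nat) :
  (forall n, (N <= n)%N -> 0 <= telescope w n) ->
  forall m n, (N <= m)%N -> (m <= n)%N -> w m <= w n.
Proof.
move=> dw m n Nm; elim: n => [|n IH]; first by rewrite leqn0 => /eqP ->.
rewrite leq_eqVlt => /predU1P[-> //|]; rewrite ltnS => mn.
by apply: le_trans (IH mn) _; rewrite -subr_ge0 dw // (leq_trans Nm).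
Qed.

(** If the differences are eventually positive, then either the sequence is
    nonnegative at some late index, and strict growth makes it positive from
    the next one on, or it stays negative. *)
Lemma nonoscillatory_of_telescope (R : realType) (w : nat -> R) :
  nonoscillatory (telescope w) -> nonoscillatory w.
Proof.
wlog [N _ dw] : w / \forall n \near \oo, 0 < telescope w n.
  move=> hw [dw|dw]; first by apply: hw => //; left.
  suff /nonoscillatoryN : nonoscillatory (fun n => - w n).
    by congr nonoscillatory; apply/funext => n; rewrite opprK.
  have dw' : \forall n \near \oo, 0 < telescope (fun n => - w n) n.
    by near do rewrite telescopeNE oppr_gt0.
  by apply: hw => //; left.
move=> _; have wN := nondecreasing_of_telescope _ _ _ (fun n h => ltW (dw n h)).
have [[M NM wM]|nw] := pselect (exists2 M, (N <= M)%N & 0 <= w M).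
  left; exists M.+1 => // n /= Mn; apply: le_lt_trans wM _.
  apply: lt_le_trans (wN M.+1 n (leqW NM) Mn).
  by rewrite -subr_gt0 dw.
right; exists N => // n /= Nn; rewrite ltNge; apply/negP => w0.
by apply: nw; exists n.
Unshelve. all: by end_near. Qed.

(** The sequence is eventually monotone and bounded. *)
Lemma is_cvg_of_telescope (R : realType) (w : nat -> R) (B : R) :
  nonoscillatory (telescope w) -> (\forall n \near \oo, `|w n| <= B) ->
  cvgn w.
Proof.
wlog [N _ dw] : w / \forall n \near \oo, 0 < telescope w n.
  move=> hw [dw|dw] wB; first by apply: hw => //; left.
  rewrite -[w]opprK; apply: is_cvgN.
  have dw' : \forall n \near \oo, 0 < telescope (fun n => - w n) n.
    by near do rewrite telescopeNE oppr_gt0.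
  by apply: hw => //; [left|near do rewrite normrN].
move=> _ [M _ wM].
have wN := nondecreasing_of_telescope _ _ _ (fun n h => ltW (dw n h)).
apply: (@near_nondecreasing_is_cvgn _ _ B).
- by exists N => // m Nm n; exact: wN.
- by exists M => // n /= Mn; apply: le_trans (ler_norm _) (wM _ Mn).
Unshelve. all: by end_near. Qed.

(** The one sign of the differences forbids cancellation: up to a global sign,
    a late increment [w n - w K] is the sum of the norms of the differences,
    which dominates a divergent sum. *)
Lemma norm_cvgy_of_telescope (R : realType) (n0 : nat) (v w : nat -> R) :
  nonoscillatory (telescope w) ->
  (\forall n \near \oo, v n <= `|telescope w n|) ->
  (fun n => \sum_(n0 <= k < n) v k) @ \oo --> +oo ->
  (fun n => `|w n|) @ \oo --> +oo.
Proof.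
move=> dw vw vy; wlog [N _ {}dw] : w vw dw / \forall n \near \oo, 0 < telescope w n.
  case: (dw) => dw' hw; first exact: hw.
  under eq_cvg do rewrite -normrN.
  apply: (hw (fun n => - w n)); last by near do rewrite telescopeNE oppr_gt0.
    by near do rewrite telescopeNE normrN.
  by left; near do rewrite telescopeNE oppr_gt0.
case: vw => M _ vw; pose K := maxn n0 (maxn N M).
have vwK n : (K <= n)%N -> v n <= telescope w n.
  by rewrite !geq_max => /and3P[_ Nn Mn]; rewrite -[leRHS]gtr0_norm ?vw ?dw.
pose S n := \sum_(n0 <= k < n) v k.
have wS n : (K <= n)%N -> S n - S K <= w n - w K.
  move=> Kn; rewrite /S (big_cat_nat _ Kn) ?leq_maxl //= addrAC subrr add0r.
  rewrite -telescope_sumr //; rewrite big_nat [leRHS]big_nat.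
  by apply: ler_sum => i /andP[Ki _]; exact: vwK.
apply/cvgryPge => A; near=> n.
apply: le_trans (ler_norm _).
have Kn : (K <= n)%N by near: n; exact: nbhs_infty_ge.
have : A + S K - w K <= S n by near: n; move/cvgryPge: vy; exact.
move: (wS n Kn); lra.
Unshelve. all: by end_near. Qed.

(** * Passing from a quasi-difference to the sequence below it *)

Lemma nonoscillatory_oddpow (R : realType) (r : R) (c u : nat -> R) :
  (\forall n \near \oo, 0 < c n) ->
  nonoscillatory (fun n => c n * oddpow (u n) r) -> nonoscillatory u.
Proof.
move=> c0 [] h; [left|right]; near=> n.
- by rewrite -(oddpow_gt0 _ _ r) -(@pmulr_rgt0 _ (c n)); near: n.
- by rewrite -(oddpow_lt0 _ _ r) -(@pmulr_rlt0 _ (c n)); near: n.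
Unshelve. all: by end_near. Qed.

(** It is enough that the quasi-difference be eventually at least 1 in norm:
    the differences of [w] are then at least [c n `^ (- r^-1)] in norm, and
    have one sign. *)
Lemma norm_cvgy_of_oddpow (R : realType) (n0 : nat) (r : R) (c w : nat -> R) :
  0 < r -> (\forall n \near \oo, 0 < c n) ->
  (fun n => \sum_(n0 <= k < n) c k `^ (- r^-1)) @ \oo --> +oo ->
  nonoscillatory (telescope w) ->
  (fun n => `|c n * oddpow (telescope w n) r|) @ \oo --> +oo ->
  (fun n => `|w n|) @ \oo --> +oo.
Proof.
move=> r0 c0 cy dw yy; apply: norm_cvgy_of_telescope dw _ cy.
near=> n.
have cn : 0 < c n by near: n.
have : 1 <= `|c n * oddpow (telescope w n) r|.
  by near: n; move/cvgryPge: yy; exact.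
rewrite normrM norm_oddpow // gtr0_norm // -ler_pdivrMl // mulr1 => h.
have -> : `|telescope w n| = (`|telescope w n| `^ r) `^ r^-1.
  by rewrite -powRrM mulfV ?gt_eqF // powRr1.
rewrite -mulN1r powRrM powR_inv1 ?(ltW cn) //.
by apply: ge0_ler_powR => //; rewrite ?nnegrE ?invr_ge0 ?powR_ge0 // ltW.
Unshelve. all: by end_near. Qed.

(** * Divergent sums of terms of one sign *)

Lemma sum_norm_cvgy (R : realType) (n0 : nat) (d : nat -> R) :
  (forall n, (n0 <= n)%N -> 0 < d n) \/ (forall n, (n0 <= n)%N -> d n < 0) ->
  ~ cvgn (fun n => \sum_(n0 <= i < n) d i) ->
  (fun n => \sum_(n0 <= i < n) `|d i|) @ \oo --> +oo.
Proof.
move=> ds dd; apply: nondecreasing_dvgn_lt.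
  move=> m n mn; have [n0m|mn0] := leqP n0 m.
    by rewrite (big_cat_nat n0m mn) /= lerDl sumr_ge0.
  by rewrite big_geq ?sumr_ge0 // ltnW.
move=> cd; apply: dd; case: ds => ds.
  suff <- : (fun n => \sum_(n0 <= i < n) `|d i|) =
            (fun n => \sum_(n0 <= i < n) d i) by [].
  apply/funext => n.
  by apply: eq_big_nat => i /andP[/ds/gtr0_norm -> _].
suff -> : (fun n => \sum_(n0 <= i < n) d i) =
          - (fun n => \sum_(n0 <= i < n) `|d i|) by apply: is_cvgN.
apply/funext => n; rewrite [RHS](_ : _ = - \sum_(n0 <= i < n) `|d i|) // -sumrN.
by apply: eq_big_nat => i /andP[/ds/ltr0_norm -> _]; rewrite opprK.
Qed.

(** * Sequences with a delayed term *)

Lemma cvg_delay (k : int) :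
  (fun n : nat => `|n%:Z - k|%N) @ \oo --> \oo.
Proof.
apply/cvgnyPge => A; near=> n.
have : (A + `|k|%N <= n)%N by near: n; exact: nbhs_infty_ge.
lia.
Unshelve. all: by end_near. Qed.

(** An eventual bound [C] on [`|u|] improves to [e + r * C] for every [e > 0],
    where [`|q| < r < 1] and [r] eventually bounds [`|p|]: the delayed index
    tends to infinity whatever the sign of [k], so the bound [C] also holds for
    the delayed term.  Iterating from [B] drives the bound below any positive
    number. *)
Lemma cvg0_of_add_delay (R : realType) (k : int) (q B : R) (p u : nat -> R) :
  `|q| < 1 -> p @ \oo --> q -> (\forall n \near \oo, `|u n| <= B) ->
  (fun n => u n + p n * delay u k n) @ \oo --> (0 : R) ->
  u @ \oo --> (0 : R).
Proof.
move=> q1 pq uB v0.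
pose r := (`|q| + 1) / 2.
have qr : `|q| < r by rewrite /r; lra.
have r1 : r < 1 by rewrite /r; lra.
have r0 : 0 <= r by rewrite /r; have := normr_ge0 q; lra.
apply/cvgr0Pnorm_le => e e0.
(* [e / 2] is the fixed point of [C |-> r * C + (1 - r) * (e / 2)], so only
   the multiple of [B] shrinks. *)
have it j : \forall n \near \oo, `|u n| <= r ^+ j * B + e / 2.
  elim: j => [|j IH].
    near=> n; have : `|u n| <= B by near: n.
    rewrite expr0; lra.
  near=> n.
  have pn : `|p n| <= r by near: n; exact: cvgr_norm_le pq _ qr.
  have vn : `|u n + p n * delay u k n| <= (1 - r) * (e / 2).
    near: n; move/cvgr0Pnorm_le : v0; apply.
    by rewrite mulr_gt0 ?subr_gt0 ?divr_gt0.
  have un : `|delay u k n| <= r ^+ j * B + e / 2.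
    by near: n; exact: (cvg_delay k _ IH).
  have -> : u n = (u n + p n * delay u k n) - p n * delay u k n by ring.
  apply: le_trans (ler_normB _ _) _; rewrite normrM.
  have := ler_pM (normr_ge0 _) (normr_ge0 _) pn un.
  rewrite exprS; lra.
have [j hj] : exists j, r ^+ j * B <= e / 2.
  have : (fun j => r ^+ j * B) @ \oo --> (0 : R).
    rewrite -(mul0r B); apply: cvgMl; apply: cvg_expr.
    by rewrite ger0_norm.
  move/cvgr0Pnorm_le => /(_ (e / 2)) []; first by rewrite divr_gt0.
  by move=> j _ /(_ j (leqnn j)) h; exists j; exact: le_trans (ler_norm _) h.
near=> n; have : `|u n| <= r ^+ j * B + e / 2 by near: n; exact: it.
lra.
Unshelve. all: by end_near. Qed.

(** The only possible limit is [z / (1 + q)], where [z] is the limit of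
    [x n + p n * x (n - k)]; subtracting it reduces to the limit 0. *)
Lemma is_cvg_of_add_delay (R : realType) (k : int) (q B : R) (p x : nat -> R) :
  `|q| < 1 -> p @ \oo --> q -> (forall n, `|x n| <= B) ->
  cvgn (fun n => x n + p n * delay x k n) -> cvgn x.
Proof.
move=> q1 pq xB /cvg_ex[/= z xz].
have q0 : 1 + q != 0 by move: q1; rewrite ltr_norml => /andP[]; lra.
pose l := z / (1 + q).
suff h : (fun n => x n - l) @ \oo --> (0 : R).
  apply/cvg_ex; exists l; rewrite -[l]add0r.
  have -> : x = (fun n => (x n - l) + l) by apply/funext => n; rewrite subrK.
  by apply: cvgD => //; exact: cvg_cst.
apply: (@cvg0_of_add_delay _ k q (B + `|l|) p) => //.
  by near=> n; apply: le_trans (ler_normB _ _) _; rewrite lerD2r.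
have -> : (fun n => x n - l + p n * delay (fun n => x n - l) k n)
   = (fun n => (x n + p n * delay x k n) - (1 + p n) * l).
  by apply/funext => n; rewrite /delay; ring.
have -> : 0 = z - (1 + q) * l by rewrite /l; field.
apply: cvgB => //; apply: cvgMl; apply: cvgD => //; exact: cvg_cst.
Unshelve. all: by end_near. Qed.

(** * Bounded solutions *)

Theorem theorem2 (R : realType) (n0 : nat) (delta tau : int)
    (alpha beta gamma : R) (p d a b c : nat -> R) (f : R -> R) (p_lim : R)
    (x : nat -> R)
    (tau_neq : tau != Num.min (-4) (delta - 4))
    (n0_ge : Num.max 1 (Num.max delta tau) <= n0%:Z)
    (alpha_odd : odd_ratio alpha) (beta_odd : odd_ratio beta)
    (gamma_odd : odd_ratio gamma)
    (d_sign : (forall n, (n0 <= n)%N -> 0 < d n) \/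
              (forall n, (n0 <= n)%N -> d n < 0))
    (a_gt0 : forall n, (n0 <= n)%N -> 0 < a n)
    (b_gt0 : forall n, (n0 <= n)%N -> 0 < b n)
    (c_gt0 : forall n, (n0 <= n)%N -> 0 < c n)
    (f_inv : tau < Num.min (-4) (delta - 4) -> bijective f)
    (p_cvg : p @ \oo --> p_lim)
    (p_lt1 : `|p_lim| < 1)
    (f_sign : forall u : R, u != 0 -> 0 < u * f u)
    (a_sum : (fun n => \sum_(n0 <= k < n) a k `^ (- alpha^-1)) @ \oo --> +oo)
    (b_sum : (fun n => \sum_(n0 <= k < n) b k `^ (- beta^-1)) @ \oo --> +oo)
    (c_sum : (fun n => \sum_(n0 <= k < n) c k `^ (- gamma^-1)) @ \oo --> +oo)
    (f_cont : continuous f)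
    (d_div : ~ cvg ((fun n => \sum_(n0 <= i < n) d i) @ \oo))
    (x_sol : solution n0 delta tau alpha beta gamma p d a b c f x)
    (x_bnd : bounded_fun x) :
  almost_oscillatory x.
Proof.
have [x0|/existsNP[m /eqP xm]] := pselect (forall n, x n = 0).
  by right; rewrite (_ : x = fun=> 0); [exact: cvg_cst | exact/funext].
have [xno|] := pselect (nonoscillatory x); last by left; split=> //; exists m.
right.
have near_gt0 (u : nat -> R) : (forall n, (n0 <= n)%N -> 0 < u n) ->
    \forall n \near \oo, 0 < u n by move=> u0; exists n0.
have [B xB] : exists B : R, forall n, `|x n| <= B.
  have /ex_bound := x_bnd; case; first exact: (globally_properfilter (a := 0%N)).
  by move=> B hB; exists B => n; exact: hB.
pose z n := x n + p n * delay x delta n.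
pose y1 n := c n * oddpow (telescope z n) gamma.
pose y2 n := b n * oddpow (telescope y1 n) beta.
pose y3 n := a n * oddpow (telescope y2 n) alpha.
have dy3 n : (n0 <= n)%N -> telescope y3 n = - (d n * f (delay x tau n)).
  by move=> /x_sol /eqP; rewrite addr_eq0 => /eqP.
have fno : nonoscillatory (fun n => f (delay x tau n)).
  have f_gt0 u : 0 < u -> 0 < f u.
    by move=> u0; rewrite -(pmulr_rgt0 _ u0) f_sign ?gt_eqF.
  have f_lt0 u : u < 0 -> f u < 0.
    by move=> u0; rewrite -(nmulr_rgt0 _ u0) f_sign ?lt_eqF.
  case: xno => /(cvg_delay tau) h.
    left; near=> n.
    by apply: f_gt0; near: n.
  by right; near=> n; apply: f_lt0; near: n.
have dno : nonoscillatory d.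
  by case: d_sign => h; [left|right]; exists n0.
have dy3_no : nonoscillatory (telescope y3).
  case: (nonoscillatoryN _ _ (nonoscillatoryM _ _ _ dno fno)) => h.
  - by left; near=> n; rewrite dy3; near: n => //; exact: nbhs_infty_ge.
  - by right; near=> n; rewrite dy3; near: n => //; exact: nbhs_infty_ge.
have dy2_no := nonoscillatory_oddpow _ _ _ _ (near_gt0 _ a_gt0)
  (nonoscillatory_of_telescope _ _ dy3_no).
have dy1_no := nonoscillatory_oddpow _ _ _ _ (near_gt0 _ b_gt0)
  (nonoscillatory_of_telescope _ _ dy2_no).
have dz_no := nonoscillatory_oddpow _ _ _ _ (near_gt0 _ c_gt0)
  (nonoscillatory_of_telescope _ _ dy1_no).
have zB : \forall n \near \oo, `|z n| <= B + B.
  near=> n; apply: le_trans (ler_normD _ _) _; rewrite lerD ?xB //.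
  rewrite normrM -[leRHS]mul1r ler_pM ?xB //.
  by near: n; exact: cvgr_norm_le p_cvg _ p_lt1.
have /cvg_ex[/= l xl] := is_cvg_of_add_delay _ _ _ _ _ _ p_lt1 p_cvg xB
  (is_cvg_of_telescope _ _ _ dz_no zB).
have [<- //|l0] := eqVneq l 0.
have fl0 : 0 < `|f l|.
  by rewrite normr_gt0; apply/eqP => fl; have := f_sign l l0; rewrite fl mulr0 ltxx.
pose m0 := `|f l| / 2.
have m0_gt0 : 0 < m0 by rewrite divr_gt0.
have fm : \forall n \near \oo, m0 <= `|f (delay x tau n)|.
  have fxl : (fun n => f (delay x tau n)) @ \oo --> f l.
    apply: (@cvg_comp _ _ _ (fun n : nat => `|n%:Z - tau|%N) (f \o x) _ \oo).
      exact: cvg_delay.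
    exact: (continuous_cvg _ (f_cont l) xl).
  by apply: cvgr_norm_ge fxl _ _; rewrite /m0; lra.
have y3y : (fun n => `|y3 n|) @ \oo --> +oo.
  apply: (norm_cvgy_of_telescope R n0 (fun n => m0 * `|d n|) y3 dy3_no).
    near=> n; rewrite dy3; last by near: n; exact: nbhs_infty_ge.
    by rewrite normrN normrM mulrC ler_wpM2l //; near: n; exact: fm.
  have /cvgryPge dy := sum_norm_cvgy _ _ _ d_sign d_div.
  apply/cvgryPge => A; near=> n; rewrite -mulr_sumr -ler_pdivrMl //.
  by near: n; exact: dy.
have y2y := norm_cvgy_of_oddpow _ _ _ _ _ (odd_ratio_gt0 _ _ alpha_odd)
  (near_gt0 _ a_gt0) a_sum dy2_no y3y.
have y1y := norm_cvgy_of_oddpow _ _ _ _ _ (odd_ratio_gt0 _ _ beta_odd)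
  (near_gt0 _ b_gt0) b_sum dy1_no y2y.
have zy := norm_cvgy_of_oddpow _ _ _ _ _ (odd_ratio_gt0 _ _ gamma_odd)
  (near_gt0 _ c_gt0) c_sum dz_no y1y.
exfalso; near \oo => n.
have : `|z n| <= B + B by near: n.
have : B + B + 1 <= `|z n| by near: n; move/cvgryPge: zy; exact.
lra.
Unshelve. all: by end_near. Qed.
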